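(* Let $k$ be an integer. If $k\not\equiv 2\pmod 4$ and $k\ge 3$, then the Möbius ladder $M_k$ is cordial.
   Context: Graphs are finite and may have multiple edges but not loops. A binary labeling of a graph $G$ is a function $f:V(G)\to\{0,1\}$. Two real numbers $x,y$ are roughly equal if $0\le |x-y|\le 1$. A binary labeling $f$ is friendly if $|f^{-1}(0)|$ and $|f^{-1}(1)|$ are roughly equal. A binary labeling $f$ induces an edge labeling $f_e:E(G)\to\{0,1\}$ by $f_e(uv)=f(u)+f(v)$ modulo 2. A friendly labeling $f$ of $G$ is cordial if $|f_e^{-1}(0)|$ and $|f_e^{-1}(1)|$ are roughly equal; a graph is cordial if it has a cordial labeling. The Möbius ladder $M_k$ consists of the cycle $C_{2k}$ together with $k$ additional edges joining the opposite pairs of vertices of the cycle. *)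

(* Defs.v *)
From HB Require Import structures.
From mathcomp Require Import all_boot all_order all_algebra.

Set Implicit Arguments.
Unset Strict Implicit.
Unset Printing Implicit Defensive.

Import Order.TTheory GRing.Theory Num.Theory.

Local Open Scope ring_scope.

(* Edges form a type of their own, so that distinct edges may have the same
   two ends; [card_ends] excludes loops. *)
Record multigraph := Multigraph {
  vertex : finType;
  edge : finType;
  ends : edge -> {set vertex};
  card_ends : forall e : edge, #|ends e| = 2%N
}.

Definition roughly_equal (R : realDomainType) (x y : R) : bool :=
  0 <= `|x - y| <= 1.

(* The labels 0 and 1 are the two elements of 'Z_2, whose addition is addition
   modulo 2. *)
Definition binary_labeling (G : multigraph) : Type := vertex G -> 'Z_2.

Definition edge_labeling (G : multigraph) (f : binary_labeling G)
    (e : edge G) : 'Z_2 :=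
  \sum_(v in ends e) f v.

Definition friendly (G : multigraph) (f : binary_labeling G) : bool :=
  roughly_equal (#|[set v | f v == 0]|%:Z) (#|[set v | f v == 1]|%:Z).

Definition cordial_labeling (G : multigraph) (f : binary_labeling G) : bool :=
  friendly f &&
  roughly_equal (#|[set e | edge_labeling f e == 0]|%:Z)
                (#|[set e | edge_labeling f e == 1]|%:Z).

Definition cordial (G : multigraph) : Prop :=
  exists f : binary_labeling G, cordial_labeling f.

Definition cycle_ends (n : nat) (i : 'I_n) : {set 'I_n} := [set i; ordS i].

(* The 2k vertices are the elements of 'I_(k + k) in cyclic order, and the
   vertex opposite to i < k is k + i. *)
Definition mobius_ends (k : nat) (e : 'I_(k + k) + 'I_k) : {set 'I_(k + k)} :=
  match e with
  | inl i => cycle_ends i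
  | inr i => [set lshift k i; rshift k i]
  end.

Lemma card_mobius_ends (k : nat) (e : 'I_(k + k) + 'I_k) :
  #|mobius_ends e| = 2%N.
Proof.
case: e => i; rewrite cards2.
- suff -> : i != ordS i by [].
  rewrite -val_eqE /=; have := ltn_ord i.
  rewrite leq_eqVlt => /predU1P[ei | lti]; last by rewrite modn_small // ltn_eqF.
  rewrite ei modnn; apply/eqP => i0.
  by move: ei; rewrite i0 addnn => /(congr1 odd); rewrite odd_double.
- by rewrite eq_lrshift.
Qed.

Definition mobius_ladder (k : nat) : multigraph :=
  Multigraph (@card_mobius_ends k).

(* Main.v *)
Require Import Defs.
From mathcomp Require Import all_boot all_order all_algebra.
From mathcomp Require Import zify.

(** Read [M_k] as a ladder with [k] rungs [(u_i, v_i)] whose last rung is joined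
    to the first one with a twist.  Label the rungs periodically by the Gray
    code 01, 00, 10, 11: each period has 12 edges, 6 of which get label 1, and
    8 vertices, 4 of which get label 1.  The twisted closure costs 1, as the
    untwisted one would, so [k = 4m] works.  For [k = 4m + 1] repeat the first
    rung 01, and for [k = 4m + 3] start the pattern at its second rung 00. *)

Lemma card_set_sum (T : finType) (h : T -> bool) :
  #|[set x | h x]| = \sum_x h x.
Proof.
rewrite cardsE -sum1_card big_mkcond; apply: eq_bigr => x _.
by case: ifP; rewrite unfold_in => ->.
Qed.

(** The two label classes are complementary, so if [s] elements have label 1 the classes differ by
    [#|T| - 2 * s] in absolute value. This leaves natural-number inequalities about a single sum. *)
Lemma roughly_equal_labels (T : finType) (f : T -> 'Z_2) (h : T -> bool) :
  (forall x, f x = (h x)%:R%R) ->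
  roughly_equal (#|[set x | f x == 0%R]|%:Z)%R (#|[set x | f x == 1%R]|%:Z)%R =
  (#|T| <= (2 * \sum_x h x).+1) && (2 * \sum_x h x <= #|T|.+1).
Proof.
move=> fh.
have -> : [set x | f x == 0%R] = ~: [set x | h x].
  by apply/setP => x; rewrite !inE fh; case: (h x).
have -> : [set x | f x == 1%R] = [set x | h x].
  by apply/setP => x; rewrite !inE fh; case: (h x).
have := cardsC [set x | h x]; rewrite -card_set_sum /roughly_equal.
move: #|_| #|_| #|_| => a b c; lia.
Qed.

(** Since [card_ends] rules out [a = b], the sum over the ends has exactly two terms, and addition
    in ['Z_2] is exclusive or. *)
Lemma edge_labeling_ends (G : multigraph) (f : binary_labeling G)
    (h : vertex G -> bool) (e : edge G) (a b : vertex G) :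
  (forall x, f x = (h x)%:R%R) -> ends e = [set a; b] ->
  edge_labeling f e = (h a (+) h b)%:R%R.
Proof.
move=> fh eab; have := card_ends e.
rewrite /edge_labeling eab cards2; case: eqVneq => // ab _.
rewrite big_setU1 ?inE //= big_set1 !fh.
by case: (h a) (h b) => -[]; apply/val_inj.
Qed.

Section LadderLabeling.

Variables (n : nat) (u v : nat -> bool).

Let rung_label (i : nat) : nat := u i (+) v i.
Let rails_label (i : nat) : nat := (u i (+) u i.+1) + (v i (+) v i.+1).

(** [split] cuts the cycle into two halves, the rails of the ladder. Opposite vertices get the same
    index, so the additional edges are the rungs. *)
Let ladder_label (x : 'I_(n.+1 + n.+1)) : bool :=
  match split x with inl i => u i | inr i => v i end.

Let edge_label (e : 'I_(n.+1 + n.+1) + 'I_n.+1) : bool :=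
  match e with
  | inl i => ladder_label i (+) ladder_label (ordS i)
  | inr i => u i (+) v i
  end.

Let ladder_labell i : ladder_label (lshift n.+1 i) = u i.
Proof. by rewrite /ladder_label -/(unsplit (inl i)) unsplitK. Qed.

Let ladder_labelr i : ladder_label (rshift n.+1 i) = v i.
Proof. by rewrite /ladder_label -/(unsplit (inr i)) unsplitK. Qed.

Let sum_ladder_label :
  \sum_x ladder_label x = \sum_(i < n.+1) (u i + v i).
Proof.
rewrite big_split_ord big_split /=; congr addn; apply: eq_bigr => i _.
  by rewrite ladder_labell.
by rewrite ladder_labelr.
Qed.

(** The cycle runs along the rail [u], crosses to [v 0], runs along the rail [v] and returns to
    [u 0]. The two crossings form the twist and stay outside the rail sum. *)
Let sum_edge_label :
  \sum_e edge_label e =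
  \sum_(i < n) rails_label i + (u n (+) v 0) + (v n (+) u 0)
  + \sum_(i < n.+1) rung_label i.
Proof.
rewrite big_sumType big_split_ord /=; congr addn.
rewrite !big_ord_recr /= !ladder_labell !ladder_labelr big_split /=.
have -> : ordS (lshift n.+1 ord_max) = rshift n.+1 (ord0 : 'I_n.+1).
  by apply: val_inj; rewrite /= addn0 modn_small; lia.
have -> : ordS (rshift n.+1 ord_max) = lshift n.+1 (ord0 : 'I_n.+1).
  by apply: val_inj; rewrite /= addnS modnn.
rewrite ladder_labell ladder_labelr /=.
have rail_u (i : 'I_n) :
    ladder_label (ordS (lshift n.+1 (widen_ord (leqnSn n) i))) = u i.+1.
  rewrite -(ladder_labell (lift ord0 i)); congr ladder_label.
  by apply: val_inj; rewrite /= modn_small //; have := ltn_ord i; lia.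
have rail_v (i : 'I_n) :
    ladder_label (ordS (rshift n.+1 (widen_ord (leqnSn n) i))) = v i.+1.
  rewrite -(ladder_labelr (lift ord0 i)); congr ladder_label.
  by apply: val_inj; rewrite /= -addnS modn_small //; have := ltn_ord i; lia.
under eq_bigr => i _ do rewrite ladder_labell rail_u.
under [X in _ + (X + _)]eq_bigr => i _ do rewrite ladder_labelr rail_v.
by rewrite addnACA addnA.
Qed.

(** Exactly half of the [2 * n.+1] vertices get label 1, and [c] of the [3 * n.+1] edges do. The
    last two hypotheses say that [3 * n.+1] and [2 * c] differ by at most 1. *)
Lemma cordial_mobius_ladder (c : nat) :
  \sum_(i < n.+1) (u i + v i) = n.+1 ->
  \sum_(i < n) rails_label i + (u n (+) v 0) + (v n (+) u 0)
    + \sum_(i < n.+1) rung_label i = c ->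
  3 * n.+1 <= (2 * c).+1 -> 2 * c <= (3 * n.+1).+1 ->
  cordial (mobius_ladder n.+1).
Proof.
move=> sum_uv sum_c c_ge c_le.
pose f : binary_labeling (mobius_ladder n.+1) := fun x => (ladder_label x)%:R%R.
exists f; apply/andP; split.
  rewrite /friendly (roughly_equal_labels _ _ ladder_label) //.
  rewrite sum_ladder_label sum_uv card_ord; lia.
rewrite (roughly_equal_labels _ _ edge_label); last first.
  case=> i.
    exact: (@edge_labeling_ends (mobius_ladder n.+1) f ladder_label (inl i)).
  rewrite (@edge_labeling_ends (mobius_ladder n.+1) f ladder_label (inr i)
             (lshift _ i) (rshift _ i)) //.
  by rewrite ladder_labell ladder_labelr.
by rewrite sum_edge_label sum_c card_sum !card_ord; lia.
Qed.

End LadderLabeling.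

Definition gray_u (i : nat) : bool := 1 < i %% 4.
Definition gray_v (i : nat) : bool := i %% 4 \in [:: 0; 3].

Lemma gray_u_mod (m i : nat) : gray_u (4 * m + i) = gray_u i.
Proof. by rewrite /gray_u mulnC modnMDl. Qed.

Lemma gray_v_mod (m i : nat) : gray_v (4 * m + i) = gray_v i.
Proof. by rewrite /gray_v mulnC modnMDl. Qed.

Lemma sum_period4 (F : nat -> nat) (m r : nat) :
  (forall i, F (4 + i) = F i) ->
  \sum_(i < 4 * m + r) F i =
  m * (F 0 + F 1 + F 2 + F 3) + \sum_(i < r) F i.
Proof.
move=> F4; elim: m => // m IHm.
rewrite mulnS -addnA !big_ord_recl /=.
rewrite (eq_bigr (fun i : 'I__ => F i)) => [|i _]; last exact: F4.
by rewrite IHm mulSn !addnA.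
Qed.

Theorem theorem4 (k : nat) (hk4 : k <> 2 %[mod 4]) (hk3 : 3 <= k) :
  cordial (mobius_ladder k).
Proof.
have gu4 i : gray_u (4 + i) = gray_u i by exact: (gray_u_mod 1).
have gv4 i : gray_v (4 + i) = gray_v i by exact: (gray_v_mod 1).
(* The residue 1 is written [4 * m + 5], hence the correction by 1 in the witness: the repeated rung
   is then followed by at least one full period. *)
have [m [->|[->|->]]] : exists m, k = (4 * m + 3).+1 \/
    k = (4 * m + 4).+1 \/ k = (4 * m + 2).+1.
  by exists (k.-1 %/ 4 - (k %% 4 == 1)); lia.
(* Consecutive Gray codes differ in one bit: the rails give [4 * m + 3], the twist 1 and the rungs
   [2 * m + 2], exactly half of the edges. *)
- apply: (@cordial_mobius_ladder _ gray_u gray_v (6 * m + 6)); try lia.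
  + rewrite -addnS (sum_period4 (fun i => gray_u i + gray_v i)) => [|i].
      by rewrite !big_ord_recr big_ord0 /=; lia.
    by rewrite gu4 gv4.
  + rewrite (sum_period4 (fun i => (gray_u i (+) gray_u i.+1)
                                   + (gray_v i (+) gray_v i.+1))); last first.
      by move=> i; rewrite -!addnS !gu4 !gv4.
    rewrite -addnS (sum_period4 (fun i => gray_u i (+) gray_v i)); last first.
      by move=> i; rewrite gu4 gv4.
    rewrite gray_u_mod gray_v_mod !big_ord_recr !big_ord0 /=; lia.
(* As [predn 0 = 0], rungs 0 and 1 are both 01. The repetition adds one rung labelled 1 and two rail
   edges labelled 0. *)
- apply: (@cordial_mobius_ladder _ (gray_u \o predn) (gray_v \o predn)
            (6 * m + 7)); try lia.
  + rewrite big_ord_recl /= (sum_period4 (fun i => gray_u i + gray_v i)) => [|i].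
      by rewrite !big_ord_recr big_ord0 /=; lia.
    by rewrite gu4 gv4.
  (* Peeling off the terms of the repeated rung leaves sums whose indices no longer need [predn]. *)
  + rewrite addnS /= gray_u_mod gray_v_mod !big_ord_recl /=.
    rewrite (sum_period4 (fun i => (gray_u i (+) gray_u i.+1)
                                   + (gray_v i (+) gray_v i.+1))); last first.
      by move=> i; rewrite -!addnS !gu4 !gv4.
    rewrite (eq_bigr (fun i : 'I__ => gray_u i.+1 (+) gray_v i.+1 : nat)) //.
    rewrite (sum_period4 (fun i => gray_u i.+1 (+) gray_v i.+1)); last first.
      by move=> i; rewrite -!addnS gu4 gv4.
    rewrite !big_ord_recr !big_ord0 /=; lia.
(* Here the ladder goes from 00 to 11, so both twist edges get label 1. With [4 * m + 2] from the
   rails and [2 * m + 1] from the rungs this gives [6 * m + 5], out of [12 * m + 9] edges. *)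
- apply: (@cordial_mobius_ladder _ (gray_u \o succn) (gray_v \o succn)
            (6 * m + 5)); try lia.
  + rewrite -addnS (sum_period4 (fun i => gray_u i.+1 + gray_v i.+1)) => [|i].
      by rewrite !big_ord_recr big_ord0 /=; lia.
    by rewrite -!addnS gu4 gv4.
  + rewrite (sum_period4 (fun i => (gray_u i.+1 (+) gray_u i.+2)
                                   + (gray_v i.+1 (+) gray_v i.+2))); last first.
      by move=> i; rewrite -!addnS !gu4 !gv4.
    rewrite -addnS (sum_period4 (fun i => gray_u i.+1 (+) gray_v i.+1)); last first.
      by move=> i; rewrite -!addnS gu4 gv4.
    rewrite /= -addnS gray_u_mod gray_v_mod !big_ord_recr !big_ord0 /=; lia.
Qed.
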